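(* Let $\mathbb{K}$ be a field of characteristic zero, let $n\ge 3$, and let $R_1$ be the $(n+2)$-dimensional Leibniz algebra over $\mathbb{K}$ with basis $\{e_1,\dots,e_n,x,y\}$ and multiplication $$[e_i,e_1]=e_{i+1}\ (2\le i\le n-1),\qquad [e_1,x]=e_1,\qquad [x,e_1]=-e_1,$$ $$[e_i,x]=(i-1)e_i\ (2\le i\le n),\qquad [e_i,y]=e_i\ (2\le i\le n),$$ all other products of basis elements being zero. Then every 2-local automorphism of $R_1$ is an automorphism of $R_1$.
   Context: A Leibniz algebra over $\mathbb{K}$ is a $\mathbb{K}$-vector space $L$ with a bilinear product $[-,-]$ satisfying $[[x,y],z]=[[x,z],y]+[x,[y,z]]$ for all $x,y,z\in L$. An automorphism of an algebra $A$ is a bijective linear map $\varphi:A\to A$ with $\varphi([u,v])=[\varphi(u),\varphi(v)]$ for all $u,v\in A$. A (not necessarily linear) map $\phi:A\to A$ is called a 2-local automorphism if for all $u,v\in A$ there exists an automorphism $\phi_{u,v}:A\to A$ (depending on $u,v$) such that $\phi(u)=\phi_{u,v}(u)$ and $\phi(v)=\phi_{u,v}(v)$. *)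

(* Defs.v *)
From HB Require Import structures.
From mathcomp Require Import all_boot all_order all_algebra.
From mathcomp Require Import zify.

Set Implicit Arguments.
Unset Strict Implicit.
Unset Printing Implicit Defensive.

Import GRing.Theory.
Local Open Scope ring_scope.

HB.mixin Record isLeibniz (K : fieldType) L of GRing.Lmodule K L := {
  bracket : L -> L -> L;
  bracket_linearl : forall v : L, linear (bracket^~ v);
  bracket_linearr : forall u : L, linear (bracket u);
  bracketA : forall x y z : L,
    bracket (bracket x y) z = bracket (bracket x z) y + bracket x (bracket y z)
}.

#[short(type="leibnizType")]
HB.structure Definition Leibniz (K : fieldType) :=
  { L of GRing.Lmodule K L & isLeibniz K L }.

Definition automorphism (K : fieldType) (A : leibnizType K) (f : A -> A) :=
  [/\ linear f, bijective f
    & forall u v : A, f (bracket u v) = bracket (f u) (f v)].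

Definition two_local_automorphism (K : fieldType) (A : leibnizType K)
    (phi : A -> A) :=
  forall u v : A, exists phi_uv : A -> A,
    [/\ automorphism phi_uv, phi u = phi_uv u & phi v = phi_uv v].

Definition R1 (K : fieldType) (n : nat) : Type := 'rV[K]_n.+2.

HB.instance Definition _ (K : fieldType) (n : nat) :=
  GRing.Lmodule.on (R1 K n).

(* Names of the basis vectors: [E i] stands for e_i, and is only meaningful   *)
(* for 1 <= i <= n.                                                           *)
Inductive R1_gen : Type := E of nat | X | Y.

(* Coordinates 0, ..., n-1 are those along e_1, ..., e_n; coordinate n is     *)
(* the one along x and coordinate n+1 the one along y.                        *)
Definition R1_gen_of_ord (n : nat) (k : 'I_n.+2) : R1_gen :=
  if (k < n)%N then E k.+1 else if k == n :> nat then X else Y.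

Definition R1_vec (K : fieldType) (n : nat) (g : R1_gen) : R1 K n :=
  match g with
  | E i => delta_mx 0 (inord i.-1)
  | X => delta_mx 0 (inord n)
  | Y => delta_mx 0 (inord n.+1)
  end.

Definition R1_table (K : fieldType) (n : nat) (g h : R1_gen) : R1 K n :=
  match g, h with
  | E i, E 1 => if (2 <= i <= n.-1)%N then R1_vec K n (E i.+1) else 0
  | E 1, X => R1_vec K n (E 1)
  | X, E 1 => - R1_vec K n (E 1)
  | E i, X => if (2 <= i <= n)%N then (i.-1)%:R *: R1_vec K n (E i) else 0
  | E i, Y => if (2 <= i <= n)%N then R1_vec K n (E i) else 0
  | _, _ => 0
  end.

Definition R1_bracket (K : fieldType) (n : nat) (u v : R1 K n) : R1 K n :=
  \sum_(i < n.+2) \sum_(j < n.+2)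
    (u 0 i * v 0 j) *: R1_table K n (R1_gen_of_ord i) (R1_gen_of_ord j).

Definition R1_gen_valid (n : nat) (g : R1_gen) : bool :=
  if g is E i then (1 <= i <= n)%N else true.

Lemma R1_gen_of_ord_valid (n : nat) (k : 'I_n.+2) :
  R1_gen_valid n (R1_gen_of_ord k).
Proof. by rewrite /R1_gen_of_ord; case: ifP => // kn; case: ifP. Qed.

Lemma R1_vec_gen_of_ord (K : fieldType) (n : nat) (k : 'I_n.+2) :
  R1_vec K n (R1_gen_of_ord k) = delta_mx 0 k.
Proof.
rewrite /R1_gen_of_ord; case: ifP => kn /=; first by rewrite inord_val.
have := ltn_ord k.
by case: eqP => nk /= kN2; congr delta_mx; apply: val_inj => /=;
  rewrite inordK //; lia.
Qed.

Lemma R1_gen_ex (n : nat) (g : R1_gen) :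
  R1_gen_valid n g -> exists k : 'I_n.+2, R1_gen_of_ord k = g.
Proof.
rewrite /R1_gen_of_ord; case: g => [i /= /andP[i1 iN]|_|_].
- exists (inord i.-1); rewrite inordK; last by lia.
  by rewrite prednK // iN.
- by exists (inord n); rewrite inordK ?ltnn ?eqxx.
- exists (inord n.+1); rewrite inordK // ifF; last by lia.
  by rewrite ifF //; lia.
Qed.

Lemma R1_bracket_linearl (K : fieldType) (n : nat) (v : R1 K n) :
  linear ((@R1_bracket K n)^~ v).
Proof.
move=> a u u'; rewrite /R1_bracket scaler_sumr -big_split.
apply: eq_bigr => i _.
rewrite scaler_sumr -big_split; apply: eq_bigr => j _ /=.
by rewrite !mxE mulrDl scalerDl -mulrA scalerA.
Qed.

Lemma R1_bracket_linearr (K : fieldType) (n : nat) (u : R1 K n) :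
  linear (R1_bracket u).
Proof.
move=> a v v'; rewrite /R1_bracket scaler_sumr -big_split.
apply: eq_bigr => i _.
rewrite scaler_sumr -big_split; apply: eq_bigr => j _ /=.
by rewrite !mxE mulrDr scalerDl mulrCA scalerA.
Qed.

Lemma R1_bracket_vec (K : fieldType) (n : nat) (g h : R1_gen) :
  R1_gen_valid n g -> R1_gen_valid n h ->
  R1_bracket (R1_vec K n g) (R1_vec K n h) = R1_table K n g h.
Proof.
move=> /R1_gen_ex[k <-] /R1_gen_ex[l <-]; rewrite !R1_vec_gen_of_ord.
rewrite /R1_bracket (bigD1 k) //= (bigD1 l) //= !mxE !eqxx mul1r scale1r.
rewrite !big1 ?addr0 // => [i ik|j jl].
  by apply: big1 => j _; rewrite !mxE (negbTE ik) andbF mul0r scale0r.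
by rewrite !mxE (negbTE jl) andbF mulr0 scale0r.
Qed.

Lemma R1_bracketA (K : fieldType) (n : nat) (u v w : R1 K n) :
  R1_bracket (R1_bracket u v) w =
  R1_bracket (R1_bracket u w) v + R1_bracket u (R1_bracket v w).
Proof.
pose B := @R1_bracket K n.
have BDl x y z : B (x + y) z = B x z + B y z.
  by have := R1_bracket_linearl z 1 x y; rewrite !scale1r.
have BDr x y z : B x (y + z) = B x y + B x z.
  by have := R1_bracket_linearr x 1 y z; rewrite !scale1r.
have B0l z : B 0 z = 0.
  by apply: (addrI (B 0 z)); rewrite -BDl !addr0.
have B0r z : B z 0 = 0.
  by apply: (addrI (B z 0)); rewrite -BDr !addr0.
have BZl a x z : B (a *: x) z = a *: B x z.
  by have := R1_bracket_linearl z a x 0; rewrite !addr0 -/B B0l addr0.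
have BZr a x z : B x (a *: z) = a *: B x z.
  by have := R1_bracket_linearr x a z 0; rewrite !addr0 -/B B0r addr0.
have BNl x z : B (- x) z = - B x z by rewrite -scaleN1r BZl scaleN1r.
have BNr x z : B x (- z) = - B x z by rewrite -scaleN1r BZr scaleN1r.
have ind (P : R1 K n -> Prop) :
    (forall g, R1_gen_valid n g -> P (R1_vec K n g)) ->
    P 0 -> (forall x y, P x -> P y -> P (x + y)) ->
    (forall a x, P x -> P (a *: x)) -> forall x, P x.
  move=> Pg P0 PD PZ x; rewrite [x]row_sum_delta.
  elim/big_rec: _ => // i y _ Py; apply: PD Py; apply: PZ.
  rewrite -R1_vec_gen_of_ord.
  exact/Pg/R1_gen_of_ord_valid.
rewrite -/B; elim/ind: u => [g vg||x y Px Py|a x Px].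
- elim/ind: v => [h vh||x y Px Py|a x Px].
  + elim/ind: w => [k vk||x y Px Py|a x Px].
    * have T g1 h1 : R1_gen_valid n g1 -> R1_gen_valid n h1 ->
          B (R1_vec K n g1) (R1_vec K n h1) = R1_table K n g1 h1.
        exact: R1_bracket_vec.
      move: T; rewrite /R1_table; move: (R1_vec K n) => e T; rewrite !T //.
      case: g h k vg vh vk => [[|[|i]]||] [[|[|j]]||] [[|[|k]]||] //= vg vh vk;
        rewrite ?(B0l, B0r, BNl, BNr) ?addr0 ?add0r ?oppr0 //;
        repeat case: ifP => ?; try lia;
        rewrite ?(B0l, B0r, BZl, BZr) ?T /= ?scaler0 ?addr0 ?add0r ?subrr
          ?oppr0 ?opprK ?addNr //; try lia;
        repeat case: ifP => ?; try lia; rewrite ?scaler0 ?oppr0 ?addr0 //.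
        by rewrite -natr1 scalerDl scale1r.
      by rewrite -[i.+2%:R]natr1 scalerDl scale1r addrK.
    * by rewrite !(B0l, B0r) addr0.
    * by rewrite !(BDl, BDr) Px Py addrACA.
    * by rewrite !(BZl, BZr) Px scalerDr.
  + by rewrite !(B0l, B0r) addr0.
  + by rewrite !(BDl, BDr) Px Py addrACA.
  + by rewrite !(BZl, BZr) Px scalerDr.
- by rewrite !(B0l, B0r) addr0.
- by rewrite !(BDl, BDr) Px Py addrACA.
- by rewrite !(BZl, BZr) Px scalerDr.
Qed.

HB.instance Definition _ (K : fieldType) (n : nat) :=
  @isLeibniz.Build K (R1 K n) (@R1_bracket K n) (@R1_bracket_linearl K n)
    (@R1_bracket_linearr K n) (@R1_bracketA K n).

(* Main.v *)
(* An automorphism of R_1 is determined by its value on w = e_1 + e_2: hence a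
   2-local automorphism phi agrees everywhere with an automorphism f such that
   f w = phi w.
   The span V of e_2, ..., e_n is the right annihilator, so it is preserved by
   every automorphism f.  Since [v, f y] = v for v in V and [y, y] = 0, f fixes
   y, so f also preserves the kernel <e_1, x, y> of [-, y].  There [x, e_1] =
   - e_1 gives f e_1 = a e_1 and f x = c e_1 + x + d y.  Writing f e_2 =
   b_2 e_2 + b_3 e_3 + ..., surjectivity forces b_2 <> 0, and [e_2, x] = e_2
   gives d = 0 and b_2 c = - b_3.  So f w = a e_1 + f e_2 determines the values
   of f on e_1, e_2 and x, and then on all e_i. *)
From HB Require Import structures.
Require Import Defs.
From mathcomp Require Import all_boot all_order all_algebra.
From mathcomp Require Import zify ring.
Import GRing.Theory.

Local Open Scope ring_scope.

Section R1Theory.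
Variables (K : fieldType) (n : nat).
Hypothesis n3 : (3 <= n)%N.
Implicit Types (u v w : R1 K n) (f g : R1 K n -> R1 K n).

(** * Coordinates *)

(** Indexed by [nat] so that shifts such as [k.-1] carry no bound. Numbering starts at 0: index k <
    n belongs to e_{k+1}, [n] to x and [n.+1] to y. *)
Definition coord u (k : nat) : K := u 0 (inord k).

Lemma coordD u v k : coord (u + v) k = coord u k + coord v k.
Proof. by rewrite /coord mxE. Qed.

Lemma coordN u k : coord (- u) k = - coord u k.
Proof. by rewrite /coord mxE. Qed.

Lemma coordZ a u k : coord (a *: u) k = a * coord u k.
Proof. by rewrite /coord mxE. Qed.

Lemma coord0 k : coord 0 k = 0.
Proof. by rewrite /coord mxE. Qed.

Lemma coord_sum (I : finType) (F : I -> R1 K n) k :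
  coord (\sum_i F i) k = \sum_i coord (F i) k.
Proof. by rewrite /coord summxE. Qed.

Lemma coordP u v :
  (forall k, (k < n.+2)%N -> coord u k = coord v k) -> u = v.
Proof.
move=> uv; apply/rowP => k.
by have := uv k (ltn_ord k); rewrite /coord inord_val.
Qed.

Lemma coord_E i k : (i < n)%N -> (k < n.+2)%N ->
  coord (R1_vec K n (E i.+1)) k = (k == i)%:R.
Proof.
move=> ltin ltkn; rewrite /coord /= mxE eqxx -val_eqE /= !inordK //; lia.
Qed.

Lemma coord_X k : (k < n.+2)%N -> coord (R1_vec K n X) k = (k == n)%:R.
Proof. by move=> ltkn; rewrite /coord mxE eqxx -val_eqE /= !inordK //; lia. Qed.

Lemma coord_Y k : (k < n.+2)%N -> coord (R1_vec K n Y) k = (k == n.+1)%:R.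
Proof. by move=> ltkn; rewrite /coord mxE eqxx -val_eqE /= !inordK //; lia. Qed.

Lemma genE i : (i < n)%N -> R1_gen_of_ord (inord i : 'I_n.+2) = E i.+1.
Proof. by move=> ltin; rewrite /R1_gen_of_ord inordK ?ltin //; lia. Qed.

Lemma genX : R1_gen_of_ord (inord n : 'I_n.+2) = X.
Proof. by rewrite /R1_gen_of_ord inordK ?ltnn ?eqxx. Qed.

Lemma genY : R1_gen_of_ord (inord n.+1 : 'I_n.+2) = Y.
Proof.
by rewrite /R1_gen_of_ord inordK // ltnNge leqnSn eqn_leq leqnSn ltnn.
Qed.

Lemma row_coord_sum u :
  u = \sum_(i < n.+2) coord u i *: R1_vec K n (R1_gen_of_ord i).
Proof.
rewrite [LHS]row_sum_delta; apply: eq_bigr => i _.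
by rewrite R1_vec_gen_of_ord /coord inord_val.
Qed.

(** * The bracket in coordinates *)

Lemma R1_bracketE u v : bracket u v = \sum_(i < n.+2) \sum_(j < n.+2)
  (coord u i * coord v j) *: R1_table K n (R1_gen_of_ord i) (R1_gen_of_ord j).
Proof.
by apply: eq_bigr => i _; apply: eq_bigr => j _; rewrite /coord !inord_val.
Qed.

(** Meant for sums over the right factor of a bracket: only e_1, x and y have nonzero right
    multiplications. *)
Lemma sum_ord_0nS (V : nmodType) (F : 'I_n.+2 -> V) :
    (forall i : 'I_n.+2, (0 < i < n)%N -> F i = 0) ->
  \sum_i F i = F (inord 0) + F (inord n) + F (inord n.+1).
Proof.
move=> F0.
have nz (i j : nat) : (i < n.+2)%N -> (j < n.+2)%N -> i != j ->
    inord j != inord i :> 'I_n.+2.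
  move=> iN jN; apply: contra => /eqP/(congr1 val) /=.
  by rewrite !inordK // => ->.
rewrite (bigD1 (inord 0)) //= (bigD1 (inord n)) /=; last by apply: nz; lia.
rewrite (bigD1 (inord n.+1)) /=; last by apply/andP; split; apply: nz; lia.
rewrite big1 ?addr0 ?addrA // => j jn; apply: F0.
by move: jn (ltn_ord j); rewrite -!val_eqE /= !inordK //; lia.
Qed.

Lemma coord_bracket u v k : coord (bracket u v) k =
  (\sum_(i < n.+2) coord u i * coord (R1_table K n (R1_gen_of_ord i) (E 1)) k)
    * coord v 0
  + (\sum_(i < n.+2) coord u i * coord (R1_table K n (R1_gen_of_ord i) X) k)
    * coord v n
  + (\sum_(i < n.+2) coord u i * coord (R1_table K n (R1_gen_of_ord i) Y) k)
    * coord v n.+1.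
Proof.
rewrite R1_bracketE exchange_big sum_ord_0nS => [|j /andP[j0 jn]]; last first.
  rewrite big1 // => i _; rewrite -{2}[j]inord_val genE //.
  case: (j : nat) j0 => // l _.
  by case: (R1_gen_of_ord i) => [[|[|?]]||]; rewrite /R1_table ?scaler0.
rewrite genX genY genE ?inordK //; last by lia.
rewrite !coordD !coord_sum !mulr_suml.
by congr (_ + _ + _); apply: eq_bigr => i _; rewrite coordZ mulrAC.
Qed.

(** In the [X] case, e_{k+1} has weight k under [-, x] except that e_1 has weight 1, hence the
    conditional. *)
Lemma coord_table (i : 'I_n.+2) k h : (k < n.+2)%N ->
  coord (R1_table K n (R1_gen_of_ord i) h) k =
  match h with
  | E 1 => ([&& 0 < i, k < n & k == i.+1]%N)%:R
           - ((i == n :> nat) && (k == 0)%N)%:R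
  | X => ((i < n)%N && (k == i))%:R * (if k == 0%N then 1 else k%:R)
  | Y => ([&& 0 < i, i < n & k == i]%N)%:R
  | _ => 0
  end.
Proof.
rewrite -{1}[i]inord_val.
move: {i}(i : nat) (ltn_ord i) => i iN kN; have [ltin|leni] := ltnP i n.
  rewrite genE //; case: i ltin {iN} => [|i] ltin; case: h => [[|[|h]]||] /=;
    rewrite ?coord0 ?mul0r ?subr0 //.
  - by rewrite (_ : 0%N == n = false) ?subr0 //; lia.
  - by rewrite coord_E //; case: eqP; rewrite ?mul0r ?mul1r.
  - rewrite (_ : i.+1 == n = false) ?subr0; last lia.
    case: ifP => i1; last by rewrite coord0 (_ : _ && _ = false) //; lia.
    by rewrite coord_E //; [congr _%:R; lia|lia].
  - rewrite ifT // coordZ coord_E // mulrC.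
    by case: eqP => [->|]; rewrite ?mul0r.
  - by rewrite ifT // coord_E // ltin.
have [/eqP ->|ni] := boolP (i == n).
  rewrite genX; case: h => [[|[|h]]||] /=;
    rewrite ?coord0 ?mul0r ?ltnn ?andbF //.
  rewrite coordN coord_E // ?eqxx /=; last lia.
  by rewrite (_ : _ && _ = false) ?sub0r //; lia.
have -> : i = n.+1 by lia.
rewrite genY; case: h => [[|[|h]]||] /=; rewrite ?coord0 ?mul0r ?subr0 //.
by case: andP => // -[]; lia.
Qed.

Lemma sum_coord1 u (b : 'I_n.+2 -> K) j : (j < n.+2)%N ->
  (forall i : 'I_n.+2, i != j :> nat -> b i = 0) ->
  \sum_(i < n.+2) coord u i * b i = coord u j * b (inord j).
Proof.
move=> jN b0; rewrite (bigD1 (inord j)) //= inordK // big1 ?addr0 // => i ij.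
by rewrite b0 ?mulr0 //; apply: contra ij => /eqP <-; rewrite inord_val.
Qed.

(** Among products of basis vectors only [e_1, x] and [x, e_1] have an e_1 component. *)
Lemma coord_bracket0 u v :
  coord (bracket u v) 0 = coord u 0 * coord v n - coord u n * coord v 0.
Proof.
rewrite coord_bracket (@sum_coord1 _ _ n) // => [|i /negPf ni]; last first.
  by rewrite coord_table // ni /= !andbF subrr.
rewrite (@sum_coord1 _ _ 0%N) // => [|i]; last first.
  by rewrite coord_table // eq_sym => /negPf ->; rewrite andbF mul0r.
rewrite big1 => [|i _]; last first.
  by rewrite coord_table //; case: (i : nat) => *; rewrite ?andbF /= mulr0.
rewrite !coord_table // !inordK // !eqxx /= andbF (ltnW (ltnW n3)) /=.
by rewrite sub0r !mulr1 mulrN1 mul0r addr0 addrC mulNr.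
Qed.

(** The factor [(1 < k)] is there because [e_1, e_1] = 0: the shift by e_1 starts at e_2, so nothing
    is shifted into e_2. *)
Lemma coord_bracketV u v k : (0 < k < n)%N ->
  coord (bracket u v) k = (1 < k)%N%:R * coord u k.-1 * coord v 0
    + coord u k * (k%:R * coord v n + coord v n.+1).
Proof.
move=> kn; have k0 : (k == 0)%N = false by lia.
have kN : (k < n.+2)%N by lia.
rewrite coord_bracket (@sum_coord1 _ _ k.-1) => [||i ik]; [|lia|]; last first.
  rewrite coord_table // k0 andbF subr0 [RHS](_ : 0 = false%:R) //.
  by congr (nat_of_bool _)%:R; lia.
rewrite (@sum_coord1 _ _ k) // => [|i]; last first.
  by rewrite coord_table // eq_sym => /negPf ->; rewrite andbF mul0r.
rewrite (@sum_coord1 _ _ k) // => [|i]; last first.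
  by rewrite coord_table // eq_sym => /negPf ->; rewrite !andbF.
rewrite !coord_table // !inordK //; last by lia.
rewrite k0 !eqxx !andbF !andbT subr0 kn.
have -> : (k < n)%N by lia.
rewrite [X in X%:R](_ : _ = (1 < k)%N :> nat); first by rewrite /= mulr1; ring.
by congr nat_of_bool; lia.
Qed.

Lemma coord_bracketXY u v k : (n <= k < n.+2)%N -> coord (bracket u v) k = 0.
Proof.
move=> kn; have kN : (k < n.+2)%N by lia.
have [k0 kn'] : (k == 0 = false /\ k < n = false)%N by lia.
rewrite coord_bracket !big1 => [|i _|i _|i _]; first by rewrite !mul0r !addr0.
- rewrite coord_table //; case: andP => [|_]; last by rewrite mulr0.
  by case=> i0 /andP[]; lia.
- by rewrite coord_table //; case: andP => [[]|_]; [lia|rewrite mul0r mulr0].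
- by rewrite coord_table // k0 kn' !andbF subr0 mulr0.
Qed.

Lemma ord_cases (P : nat -> Prop) : P 0%N ->
    (forall k, (0 < k < n)%N -> P k) -> P n -> P n.+1 ->
  forall k, (k < n.+2)%N -> P k.
Proof.
move=> P0 Pk Pn Pn1 k kN.
have [-> //|k0] := eqVneq k 0%N.
have [kn|nk] := ltnP k n; first by apply: Pk; lia.
have [-> //|kn] := eqVneq k n.
by have -> : k = n.+1 by lia.
Qed.

(** * The right annihilator and right multiplication by y *)

Lemma R1_bracket_E1 i : (0 < i)%N -> (i.+1 < n)%N ->
  bracket (R1_vec K n (E i.+1)) (R1_vec K n (E 1)) = R1_vec K n (E i.+2).
Proof.
move=> i0 iN; rewrite [LHS]R1_bracket_vec /R1_gen_valid; try lia.
by case: i i0 iN => // i _ iN; rewrite /R1_table ifT //; lia.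
Qed.

Lemma R1_bracket_XE1 :
  bracket (R1_vec K n X) (R1_vec K n (E 1)) = - R1_vec K n (E 1).
Proof. by rewrite [LHS]R1_bracket_vec // /R1_gen_valid; lia. Qed.

Lemma R1_bracket_E2X :
  bracket (R1_vec K n (E 2)) (R1_vec K n X) = R1_vec K n (E 2).
Proof.
rewrite [LHS]R1_bracket_vec // /R1_gen_valid; last by lia.
by rewrite /R1_table ifT ?scale1r //; lia.
Qed.

Lemma R1_bracket_YY : bracket (R1_vec K n Y) (R1_vec K n Y) = 0.
Proof. exact: R1_bracket_vec. Qed.

Definition right_ann v := forall u, bracket u v = 0.

Lemma right_annP v :
  right_ann v <-> [/\ coord v 0 = 0, coord v n = 0 & coord v n.+1 = 0].
Proof.
split=> [ann|[v0 vn vn1] u].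
  have:= coord_bracketV (R1_vec K n (E 2)) v 1.
  have:= coord_bracketV (R1_vec K n (E 2)) v 2.
  have:= coord_bracketV (R1_vec K n (E 3)) v 2.
  rewrite !ann !coord_E ?coord0 //=; try lia.
  rewrite mulr0 !mul0r !mul1r !addr0 !add0r.
  move=> /(_ n3) v3 /(_ n3) v2 /(_ (ltnW n3)) v1.
  (* e_2 and e_3 have weights 1 and 2 under x but the same weight under y, so subtracting isolates
     the x coordinate. *)
  have vn : coord v n = 0.
    transitivity ((2 * coord v n + coord v n.+1) - (coord v n + coord v n.+1)).
      by ring.
    by rewrite -v3 -v1 subrr.
  by split=> //; move: v1; rewrite vn !add0r.
apply: coordP; apply: ord_cases => [|k kn||]; rewrite coord0.
- by rewrite coord_bracket0 v0 vn !mulr0 subr0.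
- by rewrite coord_bracketV // v0 vn vn1 !mulr0 addr0 mulr0 addr0.
- by rewrite coord_bracketXY //; lia.
- by rewrite coord_bracketXY //; lia.
Qed.

Lemma coord_bracketY u k : (0 < k < n)%N ->
  coord (bracket u (R1_vec K n Y)) k = coord u k.
Proof.
move=> kn; rewrite coord_bracketV // !coord_Y // eqxx.
by rewrite (_ : n == n.+1 = false) ?mulr0 ?add0r ?mulr1 //; lia.
Qed.

Lemma right_ann_Y v : right_ann v -> bracket v (R1_vec K n Y) = v.
Proof.
case/right_annP=> v0 vn vn1.
apply: coordP; apply: ord_cases => [|k kn||].
- by rewrite coord_bracket0 v0 vn !mul0r subr0.
- by rewrite coord_bracketY.
- by rewrite coord_bracketXY //; lia.
- by rewrite coord_bracketXY //; lia.
Qed.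

(** [-, y] is the projection onto V along e_1, x and y. *)
Lemma rbracket_Y_kerP u : bracket u (R1_vec K n Y) = 0 <->
  forall k, (0 < k < n)%N -> coord u k = 0.
Proof.
split=> [uY k kn|u0]; first by rewrite -coord_bracketY // uY coord0.
apply: coordP; apply: ord_cases => [|k kn||]; rewrite coord0.
- rewrite coord_bracket0 !coord_Y //.
  by rewrite (_ : n == n.+1 = false) ?mulr0 ?subr0 //; lia.
- by rewrite coord_bracketY ?u0.
- by rewrite coord_bracketXY //; lia.
- by rewrite coord_bracketXY //; lia.
Qed.

Lemma right_ann_E i : (0 < i < n)%N -> right_ann (R1_vec K n (E i.+1)).
Proof.
move=> iN; apply/right_annP; rewrite !coord_E; try lia.
by split; [case: i iN | rewrite (_ : _ == _ = false) //; lia..].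
Qed.

(** * Values of an automorphism on the basis *)

Lemma linear_coord f u : linear f ->
  f u = \sum_(i < n.+2) coord u i *: f (R1_vec K n (R1_gen_of_ord i)).
Proof.
move=> flin; pose F : {linear R1 K n -> R1 K n} := HB.pack f
  (GRing.isLinear.Build K (R1 K n) (R1 K n) _ f flin).
rewrite -[f]/(F : _ -> _) {1}[u]row_coord_sum linear_sum.
by apply: eq_bigr => i _; rewrite linearZ.
Qed.

Section Automorphism.
Variable f : R1 K n -> R1 K n.
Hypothesis autf : automorphism f.

Let flin : linear f. Proof. by case: autf. Qed.
Let fM u v : f (bracket u v) = bracket (f u) (f v).
Proof. by case: autf. Qed.
Let fK u : exists w, f w = u.
Proof. by case: autf => _ [g _ gK] _; exists (g u). Qed.
Let finj : injective f.
Proof. by case: autf => _ /bij_inj. Qed.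

Let f0 : f 0 = 0.
Proof. by have := flin (-1) 0 0; rewrite scaler0 addr0 scaleN1r addNr. Qed.

Let fN u : f (- u) = - f u.
Proof. by have := flin (-1) u 0; rewrite f0 !addr0 !scaleN1r. Qed.

Lemma automorphism_right_ann v : right_ann v <-> right_ann (f v).
Proof.
split=> ann u; last by apply: finj; rewrite fM ann f0.
by have [w <-] := fK u; rewrite -fM ann f0.
Qed.

Lemma automorphism_Y : f (R1_vec K n Y) = R1_vec K n Y.
Proof.
set y := f _.
have fix_y v : right_ann v -> bracket v y = v.
  have [w <-] := fK v => /(proj2 (automorphism_right_ann _)) ann.
  by rewrite -fM right_ann_Y.
have y2 := fix_y _ (right_ann_E _ (ltnW n3 : 0 < 1 < n)%N).
have y3 := fix_y _ (right_ann_E _ (n3 : 0 < 2 < n)%N).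
have:= coord_bracketV (R1_vec K n (E 2)) y 1.
have:= coord_bracketV (R1_vec K n (E 2)) y 2.
have:= coord_bracketV (R1_vec K n (E 3)) y 2.
rewrite y2 y3 !coord_E //=; try lia.
rewrite mulr0 !mul0r !mul1r !addr0 !add0r.
move=> /(_ n3) v3 /(_ n3) v2 /(_ (ltnW n3)) v1.
have vn : coord y n = 0.
  transitivity ((2 * coord y n + coord y n.+1) - (coord y n + coord y n.+1)).
    by ring.
  by rewrite -v3 -v1 subrr.
have vn1 : coord y n.+1 = 1 by move: v1; rewrite vn add0r => <-.
apply: coordP; apply: ord_cases => [|k kn||]; rewrite coord_Y //; try lia.
(* The coordinates of f y along e_1, x, y are 0, 0, 1, so the k-th coordinate of [f y, f y] = 0 is
   that of f y itself. *)
- have := fM (R1_vec K n Y) (R1_vec K n Y); rewrite R1_bracket_YY f0 -/y.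
  move=> /(congr1 (fun z => coord z k)); rewrite coord0 coord_bracketV //.
  rewrite -v2 vn vn1 !mulr0 !add0r mulr1 => <-.
  by rewrite (_ : _ == _ = false) //; lia.
- by rewrite vn (_ : _ == _ = false) //; lia.
- by rewrite eqxx.
Qed.

(** As f y = y, f commutes with [-, y] and preserves its kernel. *)
Lemma automorphism_ker_Y u : (forall k, (0 < k < n)%N -> coord u k = 0) ->
  forall k, (0 < k < n)%N -> coord (f u) k = 0.
Proof.
move/rbracket_Y_kerP=> uY; apply/rbracket_Y_kerP.
by rewrite -automorphism_Y -fM uY.
Qed.

Lemma automorphism_E1 k : (0 < k < n.+2)%N ->
  coord (f (R1_vec K n (E 1))) k = 0.
Proof.
move=> kN; have [kn|nk] := ltnP k n.
  apply: automorphism_ker_Y; last by lia.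
  by move=> l ln; rewrite coord_E; [case: eqP => [|//]; lia | lia | lia].
(* e_1 = - [x, e_1], and brackets have no x or y component. *)
rewrite -[R1_vec K n (E 1)]opprK -R1_bracket_XE1 fN fM coordN.
by rewrite coord_bracketXY ?oppr0 //; lia.
Qed.

Lemma automorphism_E1_neq0 : coord (f (R1_vec K n (E 1))) 0 != 0.
Proof.
apply/eqP => a0; have : f (R1_vec K n (E 1)) = f 0.
  rewrite f0; apply: coordP => -[|k] kN; rewrite coord0 //.
  exact: automorphism_E1.
move/finj/(congr1 (fun z => coord z 0)); rewrite coord0 coord_E //; last lia.
by move/eqP; rewrite oner_eq0.
Qed.

(** Compare e_1 coordinates in [f x, f e_1] = - f e_1 and cancel that of f e_1, which is nonzero. *)
Lemma automorphism_X_n : coord (f (R1_vec K n X)) n = 1.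
Proof.
have := congr1 (fun z => coord (f z) 0) R1_bracket_XE1.
rewrite /= fM coord_bracket0 fN coordN automorphism_E1 ?mulr0 ?sub0r; last lia.
by move/oppr_inj/eqP; rewrite -{2}[coord _ 0]mul1r
  (inj_eq (mulIf automorphism_E1_neq0)) => /eqP.
Qed.

Lemma automorphism_X_V k : (0 < k < n)%N -> coord (f (R1_vec K n X)) k = 0.
Proof.
apply: automorphism_ker_Y => l ln.
by rewrite coord_X; [case: eqP => [|//]; lia | lia].
Qed.

(** In a preimage of e_2, only the e_2 term can contribute to the e_2 coordinate of the image. *)
Lemma automorphism_E2_neq0 : coord (f (R1_vec K n (E 2))) 1 != 0.
Proof.
have [u /(congr1 (fun z => coord z 1))] := fK (R1_vec K n (E 2)).
rewrite coord_E //; last by lia.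
rewrite (linear_coord _ _ flin) coord_sum (bigD1 (inord 1)) //=.
rewrite big1 => [|i i1].
  rewrite addr0 coordZ genE; last by lia.
  by move/eqP => e; apply/eqP => e0; move: e; rewrite e0 mulr0 eq_sym oner_eq0.
rewrite coordZ [X in _ * X](_ : _ = 0) ?mulr0 //.
have {i1} : i != 1 :> nat.
  by apply: contra i1 => /eqP i1; apply/eqP/val_inj; rewrite /= inordK.
rewrite -[i in R1_gen_of_ord i]inord_val.
move: (i : nat) (ltn_ord i); apply: ord_cases => [|k kn||] i1.
- by rewrite genE ?automorphism_E1 //; lia.
- rewrite genE; last by lia.
  (* For i > 2, f e_i = [f e_{i-1}, f e_1] with f e_1 a multiple of e_1, so it has no e_2
     component. *)
  case: k kn i1 => // -[//|k] kn _.
  rewrite -R1_bracket_E1 // fM coord_bracketV /=; last by lia.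
  rewrite !mul0r add0r !automorphism_E1; [|lia|lia].
  by rewrite mulr0 addr0 mulr0.
- by rewrite genX automorphism_X_V //; lia.
- by rewrite genY automorphism_Y coord_Y //; case: eqP => [|//]; lia.
Qed.

Lemma automorphism_X_n1 : coord (f (R1_vec K n X)) n.+1 = 0.
Proof.
have := congr1 (fun z => coord (f z) 1) R1_bracket_E2X.
rewrite /= fM coord_bracketV /=; last by lia.
rewrite !mul0r add0r automorphism_X_n mulr1 -[RHS]mulr1.
move/(mulfI automorphism_E2_neq0); rewrite -[X in _ = X -> _]addr0.
exact: addrI.
Qed.

(** Read off the e_3 coordinate of [f e_2, f x] = f e_2. As the e_2 coordinate of f e_2 is nonzero,
    f e_2 thus determines the e_1 coordinate of f x. *)
Lemma automorphism_X_0 :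
  coord (f (R1_vec K n (E 2))) 1 * coord (f (R1_vec K n X)) 0 =
  - coord (f (R1_vec K n (E 2))) 2.
Proof.
have := congr1 (fun z => coord (f z) 2) R1_bracket_E2X.
rewrite /= fM coord_bracketV // automorphism_X_n automorphism_X_n1 /=.
rewrite mulr1n mul1r mulr1 addr0; set a := coord _ 0; set b := coord _ 1.
set c := coord _ 2 => e; transitivity (b * a + c * 2 - c * 2); first by ring.
by rewrite e; ring.
Qed.

End Automorphism.

(** * Rigidity of automorphisms and the 2-local case *)

Lemma automorphism_eq f g : automorphism f -> automorphism g ->
  f (R1_vec K n (E 1) + R1_vec K n (E 2))
    = g (R1_vec K n (E 1) + R1_vec K n (E 2)) ->
  f =1 g.
Proof.
move=> af ag.
have [flin _ fM] := af; have [glin _ gM] := ag.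
have := flin 1 (R1_vec K n (E 1)) (R1_vec K n (E 2)).
have := glin 1 (R1_vec K n (E 1)) (R1_vec K n (E 2)).
rewrite !scale1r => -> -> fg.
(* h e_2 lies in V, so the e_1 coordinate of h w comes from h e_1 alone; this separates the two
   summands. *)
have E2_0 h : automorphism h -> coord (h (R1_vec K n (E 2))) 0 = 0.
  move=> ah; have /right_annP[] // : right_ann (h (R1_vec K n (E 2))).
  by apply/(proj1 (automorphism_right_ann _ ah _))/right_ann_E; lia.
have fgE1 : f (R1_vec K n (E 1)) = g (R1_vec K n (E 1)).
  apply: coordP => -[|k] kN; last by rewrite !automorphism_E1.
  move: (congr1 (fun z => coord z 0) fg).
  by rewrite /= !coordD !E2_0 // !addr0.
have fgE2 : f (R1_vec K n (E 2)) = g (R1_vec K n (E 2)).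
  by move: fg; rewrite fgE1 => /addrI.
have fgX : f (R1_vec K n X) = g (R1_vec K n X).
  apply: coordP; apply: ord_cases => [|k kn||].
  - apply: (mulfI (automorphism_E2_neq0 _ af)).
    by rewrite [in RHS]fgE2 !automorphism_X_0 // fgE2.
  - by rewrite !automorphism_X_V.
  - by rewrite !automorphism_X_n.
  - by rewrite !automorphism_X_n1.
have fgE i : (i < n)%N -> f (R1_vec K n (E i.+1)) = g (R1_vec K n (E i.+1)).
  elim: i => [//|[//|i] IH] iN.
  by rewrite -R1_bracket_E1 // fM gM IH ?fgE1 //; lia.
move=> u; rewrite (linear_coord _ _ flin) (linear_coord _ _ glin).
apply: eq_bigr => i _; congr (_ *: _).
rewrite -[i]inord_val; move: (i : nat) (ltn_ord i).
apply: ord_cases => [|k kn||].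
- by rewrite genE ?fgE //; lia.
- by rewrite genE ?fgE //; lia.
- by rewrite genX.
- by rewrite genY !automorphism_Y.
Qed.
End R1Theory.

Theorem theorem4p2 (K : fieldType) (charK0 : [pchar K] =i pred0)
    (n : nat) (hn : (3 <= n)%N) (phi : R1 K n -> R1 K n) :
  two_local_automorphism phi -> automorphism phi.
Proof.
set w := R1_vec K n (E 1) + R1_vec K n (E 2) => loc.
have [f [autf _ fw]] := loc w w.
have phiE : phi =1 f.
  (* Pairing u with w gives g with g u = phi u and g w = phi w = f w, which forces g = f. *)
  move=> u; have [g [autg -> gw]] := loc u w.
  by apply: (automorphism_eq _ _ hn _ _ autg autf); rewrite -fw gw.
have [flin fbij fM] := autf; split=> [a u v||u v]; rewrite ?phiE //.
- exact: flin.
- by apply: eq_bij fbij _ _ => u; rewrite phiE.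
Qed.
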